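(* Let $G$ be a connected non-bipartite $Q$-integral graph with $Q$-spectral radius at most $6$. Then $G$ is isomorphic to one of the eight graphs $G_1, G_2, \dots, G_8$ listed in the context.
   Context: All graphs are finite and simple. For a graph $G$, let $A(G)$ be its adjacency matrix and $D(G)$ the diagonal matrix of its vertex degrees; the signless Laplacian matrix of $G$ is $Q(G) = A(G) + D(G)$. The graph $G$ is $Q$-integral if all eigenvalues of $Q(G)$ are integers. The $Q$-spectral radius of $G$ is the largest eigenvalue of $Q(G)$. The graphs $G_1,\dots,G_8$ are the following (in each case the vertices are those occurring in the edge list). $G_1$ (3 vertices, the triangle $K_3$): edges $c_0c_1, c_0c_2, c_1c_2$. $G_2$ (6 vertices, two disjoint triangles joined by one edge): edges $xy, xx_0, xx_2, x_0x_2, yy_0, yy_2, y_0y_2$. $G_3$ (4 vertices): the complete graph $K_4$. $G_4$ (10 vertices, the Petersen graph): edges $n_1n_3, n_3n_5, n_5n_2, n_2n_4, n_4n_1, b_1b_2, b_2b_3, b_3b_4, b_4b_5, b_5b_1, n_1b_1, n_2b_2, n_3b_3, n_4b_4, n_5b_5$. $G_5$ (6 vertices, the triangular prism): edges $c_0c_1, c_0c_2, c_1c_2, b_0b_1, b_0b_2, b_1b_2, c_0b_0, c_1b_1, c_2b_2$. $G_6$ (10 vertices): edges $n_1n_2, n_1n_5, n_2n_3, n_3n_4, n_4n_2, n_5n_6, n_6n_7, n_7n_5, n_3n_9, n_7n_8, n_4n_8, n_6n_9, n_1n_{10}, n_9n_{10}, n_8n_{10}$. $G_7$ (12 vertices):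 edges $b_0b_1, b_0b_2, b_1b_2, c_0b_0, c_1b_1, c_2b_2, c_0x_0, c_0x_1, x_0x_1, c_1y_0, c_1y_1, y_0y_1, c_2z_0, c_2z_1, z_0z_1, x_0y_1, y_0z_1, z_0x_1$. $G_8$ (6 vertices): edges $xy, xx_0, xx_1, xy_1, yy_0, yy_1, x_0x_1, y_0y_1$. *)

(* Defs.v *)
From HB Require Import structures.
From mathcomp Require Import all_boot all_order all_algebra all_field.

Set Implicit Arguments.
Unset Strict Implicit.
Unset Printing Implicit Defensive.

Import Order.TTheory GRing.Theory Num.Theory.
Local Open Scope ring_scope.

Record sgraph := SGraph {
  vertex :> finType;
  adj : rel vertex;
  adj_sym : symmetric adj;
  adj_irrefl : irreflexive adj
}.

Definition degree (G : sgraph) (x : G) : nat := #|[set y | adj x y]|.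

Definition connected (G : sgraph) : Prop :=
  (0 < #|G|)%N /\ forall x y : G, connect (@adj G) x y.

Definition bipartite (G : sgraph) : Prop :=
  exists A : {set G}, forall x y : G, adj x y -> (x \in A) != (y \in A).

Definition isomorphic (G H : sgraph) : Prop :=
  exists f : G -> H, bijective f /\ forall x y : G, adj (f x) (f y) = adj x y.

(* Rows and columns are indexed by the vertices in the order of enum G.  The
   coefficients are taken in algC, so that eigenvalues range over all complex
   eigenvalues: those of an integer matrix are algebraic numbers. *)
Definition adjacency_mx (G : sgraph) : 'M[algC]_#|G| :=
  \matrix_(i, j) (adj (enum_val i) (enum_val j))%:R.

Definition degree_mx (G : sgraph) : 'M[algC]_#|G| :=
  diag_mx (\row_i (degree (enum_val i))%:R).

Definition signless_laplacian (G : sgraph) : 'M[algC]_#|G| :=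
  adjacency_mx G + degree_mx G.

Definition Q_integral (G : sgraph) : Prop :=
  forall a : algC, eigenvalue (signless_laplacian G) a -> a \is a Num.int.

(* The order of algC is partial (x <= y iff y - x is a nonnegative real), but
   signless_laplacian G is real symmetric, so its eigenvalues are comparable. *)
Definition Q_spectral_radius (G : sgraph) (mu : algC) : Prop :=
  eigenvalue (signless_laplacian G) mu /\
  forall a : algC, eigenvalue (signless_laplacian G) a -> a <= mu.

Section EdgeList.
Local Open Scope nat_scope.

Definition edge_list_adj (n : nat) (E : seq (nat * nat)) : rel 'I_n :=
  fun i j => (i != j) &&
    (((i : nat, j : nat) \in E) || ((j : nat, i : nat) \in E)).

Lemma edge_list_adj_sym n E : symmetric (@edge_list_adj n E).
Proof. by move=> i j; rewrite /edge_list_adj eq_sym orbC. Qed.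

Lemma edge_list_adj_irrefl n E : irreflexive (@edge_list_adj n E).
Proof. by move=> i; rewrite /edge_list_adj eqxx. Qed.

Definition edge_list_graph (n : nat) (E : seq (nat * nat)) : sgraph :=
  SGraph (@edge_list_adj_sym n E) (@edge_list_adj_irrefl n E).

(* In each graph below the n vertex names are numbered 0, ..., n - 1 by the
   let-bindings; a name with an index, such as c_i, is written c i. *)
Definition G1 : sgraph :=
  let c i := i in
  edge_list_graph 3 [:: (c 0, c 1); (c 0, c 2); (c 1, c 2)].

Definition G2 : sgraph :=
  let x := 0 in let x0 := 1 in let x2 := 2 in
  let y := 3 in let y0 := 4 in let y2 := 5 in
  edge_list_graph 6
    [:: (x, y); (x, x0); (x, x2); (x0, x2); (y, y0); (y, y2); (y0, y2)].

Definition G3 : sgraph :=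
  edge_list_graph 4 [:: (0, 1); (0, 2); (0, 3); (1, 2); (1, 3); (2, 3)].

Definition G4 : sgraph :=
  let n i := i.-1 in let b i := 5 + i.-1 in
  edge_list_graph 10
    [:: (n 1, n 3); (n 3, n 5); (n 5, n 2); (n 2, n 4); (n 4, n 1);
        (b 1, b 2); (b 2, b 3); (b 3, b 4); (b 4, b 5); (b 5, b 1);
        (n 1, b 1); (n 2, b 2); (n 3, b 3); (n 4, b 4); (n 5, b 5)].

Definition G5 : sgraph :=
  let c i := i in let b i := 3 + i in
  edge_list_graph 6
    [:: (c 0, c 1); (c 0, c 2); (c 1, c 2); (b 0, b 1); (b 0, b 2); (b 1, b 2);
        (c 0, b 0); (c 1, b 1); (c 2, b 2)].

Definition G6 : sgraph :=
  let n i := i.-1 in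
  edge_list_graph 10
    [:: (n 1, n 2); (n 1, n 5); (n 2, n 3); (n 3, n 4); (n 4, n 2);
        (n 5, n 6); (n 6, n 7); (n 7, n 5); (n 3, n 9); (n 7, n 8);
        (n 4, n 8); (n 6, n 9); (n 1, n 10); (n 9, n 10); (n 8, n 10)].

Definition G7 : sgraph :=
  let b i := i in let c i := 3 + i in
  let x i := 6 + i in let y i := 8 + i in let z i := 10 + i in
  edge_list_graph 12
    [:: (b 0, b 1); (b 0, b 2); (b 1, b 2);
        (c 0, b 0); (c 1, b 1); (c 2, b 2);
        (c 0, x 0); (c 0, x 1); (x 0, x 1);
        (c 1, y 0); (c 1, y 1); (y 0, y 1);
        (c 2, z 0); (c 2, z 1); (z 0, z 1);
        (x 0, y 1); (y 0, z 1); (z 0, x 1)].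

Definition G8 : sgraph :=
  let x := 0 in let x0 := 1 in let x1 := 2 in
  let y := 3 in let y0 := 4 in let y1 := 5 in
  edge_list_graph 6
    [:: (x, y); (x, x0); (x, x1); (x, y1); (y, y0); (y, y1);
        (x0, x1); (y0, y1)].

End EdgeList.

(* Main.v *)
From HB Require Import structures.
From Stdlib Require Import ZArith.
From mathcomp Require Import all_boot all_order all_algebra all_field.
From mathcomp Require Import ring zify ssrZ.
Require Import Defs.

Set Implicit Arguments.
Unset Strict Implicit.
Unset Printing Implicit Defensive.

Import Order.TTheory GRing.Theory Num.Theory.
Local Open Scope ring_scope.

                               

(** Write Q for the signless Laplacian. Its quadratic form is the sum of |u x + u y|^2 over the
    edges, so for a connected non-bipartite graph every eigenvalue is positive ([eigenvalue_gt0]).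
    By integrality the spectrum lies in {1, ..., m}, where m <= 6 is the spectral radius. By a
    Perron-Frobenius argument the eigenvalue m is simple with a positive eigenvector. Hence M = (Q -
    1)(Q - 2)...(Q - (m - 1)) is (m - 1)! times the orthogonal projector onto a line: an integer
    matrix of rank one with positive entries ([shifts_rank1], [shifts_gt0], [shifts_sqr]).

    Choose r with M r r maximal and let a be the row of M at r. Then a is a Perron vector of
    positive integers, largest at r, with M x x = a x ^ 2 / a r an integer and with sum of squares
    (m - 1)! * a r. In particular a r <= (m - 1)!, and the number of vertices is bounded. Moreover,
    at each vertex x the squared moduli of the eigenvectors form a probability measure on {1, ...,
    m} whose moments are the diagonal entries of the powers of Q at x. So every polynomial that is
    nonnegative on {1, ..., m} gives an inequality between local data of the graph
    ([combination_ge0]). One of these gives 2 <= degree x <= m - 2, so m is 4, 5 or 6.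

    All this is collected by [certificate_exists]. What is left is finite: [search] grows a graph
    from r, labelling each vertex by the pair of a x and its degree, and cuts a branch as soon as
    one of the necessary conditions fails. The branch followed by the given graph is never cut
    ([search_sound]), and evaluation of [search_all] for m = 4, 5, 6 confirms that every completed
    candidate with the right matrix M is one of the eight graphs. *)

Definition qop (G : sgraph) (R : nzRingType) (u : G -> R) (x : G) : R :=
  (degree x)%:R * u x + \sum_(y | adj x y) u y.

(** * An orthonormal eigenbasis of Q *)

Section Eigenbasis.

Variable G : sgraph.

Lemma mul_signless_laplacian (v : 'rV[algC]_#|G|) j :
  (v *m signless_laplacian G) 0 j =
  qop (fun x => v 0 (enum_rank x)) (enum_val j).
Proof.
rewrite mxE /qop enum_valK.
under eq_bigr do rewrite !mxE mulrDr.
rewrite big_split /= addrC; congr (_ + _).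
  rewrite (bigD1 j) //= eqxx mulr1n mulrC big1 ?addr0 // => i /negPf->.
  by rewrite mulr0n mulr0.
rewrite (reindex (@enum_rank G)) /=; last first.
  by exists enum_val => i _; [exact: enum_rankK|exact: enum_valK].
rewrite [RHS]big_mkcond /=; apply: eq_bigr => y _.
by rewrite enum_rankK adj_sym; case: adj; rewrite ?mulr1 ?mulr0.
Qed.

Lemma eigenvalue_signless_laplacianP (c : algC) :
  reflect (exists2 u : G -> algC, qop u =1 (fun x => c * u x) & exists x, u x != 0)
          (eigenvalue (signless_laplacian G) c).
Proof.
apply: (iffP eigenvalueP) => [[v vQ v0]|[u uQ [x ux]]].
  exists (fun x => v 0 (enum_rank x)).
    move=> x; have /rowP/(_ (enum_rank x)) := vQ.
    by rewrite mul_signless_laplacian enum_rankK !mxE.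
  have [j vj] : exists j, v 0 j != 0 by apply/rV0Pn.
  by exists (enum_val j); rewrite enum_valK.
exists (\row_j u (enum_val j)).
  apply/rowP => j; rewrite mul_signless_laplacian !mxE -uQ /qop !mxE enum_rankK.
  by congr (_ + _); apply: eq_bigr => y _; rewrite mxE enum_rankK.
apply/rV0Pn; exists (enum_rank x); by rewrite mxE enum_rankK.
Qed.

(** This is the spectral theorem for the real symmetric matrix Q. The last two identities are the
    two halves of the unitarity of the change of basis: completeness of the eigenvectors and their
    orthonormality. *)
Lemma signless_laplacian_eigenbasis :
  exists (phi : 'I_#|G| -> G -> algC) (lam : 'I_#|G| -> algC),
  [/\ forall i, eigenvalue (signless_laplacian G) (lam i),
      forall i, qop (phi i) =1 (fun x => lam i * phi i x),
      forall x y, \sum_i phi i x * (phi i y)^* = (x == y)%:R &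
      forall i j, \sum_x phi i x * (phi j x)^* = (i == j)%:R].
Proof.
set Q := signless_laplacian G.
have Qsym : Q \is symmetricmx.
  apply/is_hermitianmxP; rewrite expr0 scale1r map_mx_id //.
  apply/matrixP => i j; rewrite !mxE adj_sym; congr (_ + _).
  by rewrite eq_sym; case: eqP => [->|_]; rewrite ?mulr1n ?mulr0n.
have Qreal : Q \is a mxOver Num.real.
  by apply/mxOverP => i j; rewrite !mxE rpredD ?rpredMn ?rpred_nat ?rpred1.
have /orthomx_spectralP := symmetric_normalmx Qsym Qreal.
set P := spectralmx Q; set l := spectral_diag Q => QE.
have PU : P \is unitarymx by exact: spectral_unitarymx.
have PQ : P *m Q = diag_mx l *m P.
  by rewrite QE !mulmxA mulmxV ?mul1mx // unitarymx_unit.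
have PQE i : qop (fun x => P i (enum_rank x)) =1 (fun x => l 0 i * P i (enum_rank x)).
  move=> x; have /rowP/(_ (enum_rank x)) : row i P *m Q = l 0 i *: row i P.
    by rewrite -row_mul PQ; apply/rowP => j; rewrite mul_diag_mx !mxE.
  rewrite mul_signless_laplacian enum_rankK !mxE => <-.
  by rewrite /qop !mxE; congr (_ + _); apply: eq_bigr => y _; rewrite mxE.
have PP i j : \sum_x P i (enum_rank x) * (P j (enum_rank x))^* = (i == j)%:R.
  have /unitarymxP/matrixP/(_ i j) := PU; rewrite !mxE => <-.
  rewrite [RHS](reindex (@enum_rank G)) /=; last first.
    by exists enum_val => k _; [exact: enum_rankK|exact: enum_valK].
  by apply: eq_bigr => x _; rewrite !mxE.
exists (fun i x => P i (enum_rank x)), (fun i => l 0 i); split => //.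
  move=> i; apply/eigenvalue_signless_laplacianP.
  exists (fun x => P i (enum_rank x)) => //; apply/existsP.
  apply: contraT; rewrite negb_exists => /forallP P0.
  have := PP i i; rewrite eqxx big1 => [/esym/eqP|x _]; first by rewrite oner_eq0.
  by have := P0 x; rewrite negbK => /eqP->; rewrite mul0r.
move=> x y; have := mulVmx (unitarymx_unit PU); rewrite invmx_unitary //.
move/matrixP/(_ (enum_rank y) (enum_rank x)); rewrite !mxE.
rewrite (inj_eq enum_rank_inj) eq_sym => <-.
by apply: eq_bigr => i _; rewrite !mxE mulrC.
Qed.

End Eigenbasis.

(** * Entries of polynomials in Q, computed column by column *)

Section QColumn.

Variable G : sgraph.

                                                                       
                                
(** This is the entry at (x, y) of the product of the matrices Q - j for j in [s]. Being defined
    over any ring, it gives integrality over [int] and a spectral formula over [algC], and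
    [qcol_intr] links the two. *)
Fixpoint qcol (R : nzRingType) (s : seq R) (y x : G) : R :=
  if s is j :: s' then qop (qcol s' y) x - j * qcol s' y x else (x == y)%:R.

Lemma qop_intr (R : nzRingType) (u : G -> int) x :
  (qop u x)%:~R = qop (fun y => (u y)%:~R : R) x.
Proof. by rewrite /qop rmorphD rmorphM /= rmorph_nat rmorph_sum. Qed.

Lemma eq_qop (R : nzRingType) (u v : G -> R) : u =1 v -> qop u =1 qop v.
Proof.
by move=> uv x; rewrite /qop uv; congr (_ + _); apply: eq_bigr => y _; rewrite uv.
Qed.

Lemma qcol_intr (R : nzRingType) (s : seq int) y x :
  (qcol s y x)%:~R = qcol [seq j%:~R : R | j <- s] y x.
Proof.
elim: s x => [|j s IHs] x /=; first by rewrite rmorph_nat.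
by rewrite rmorphB rmorphM /= qop_intr IHs (eq_qop IHs).
Qed.

Lemma qopB (R : nzRingType) (u v : G -> R) x :
  qop (fun y => u y - v y) x = qop u x - qop v x.
Proof. by rewrite /qop mulrBr sumrB opprD addrACA. Qed.

Lemma qopZ (R : comNzRingType) c (u : G -> R) x :
  qop (fun y => c * u y) x = c * qop u x.
Proof. by rewrite /qop mulrDr mulr_sumr mulrCA. Qed.

Lemma qop_sum (R : nzRingType) (I : finType) (u : I -> G -> R) x :
  qop (fun y => \sum_i u i y) x = \sum_i qop (u i) x.
Proof. by rewrite /qop mulr_sumr exchange_big /= -big_split. Qed.

End QColumn.

(** * Perron-Frobenius theory and the integral rank-one matrix M *)

Section Spectrum.

Variables (G : sgraph) (m : nat).
Hypothesis Gconn : connected G.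
Variables (phi : 'I_#|G| -> G -> algC) (lam : 'I_#|G| -> algC).
Hypothesis phi_eigen : forall i, qop (phi i) =1 (fun x => lam i * phi i x).
Hypothesis phi_cols : forall x y, \sum_i phi i x * (phi i y)^* = (x == y)%:R.
Hypothesis phi_rows : forall i j, \sum_x phi i x * (phi j x)^* = (i == j)%:R.
Hypothesis lam_range : forall i, exists2 k : nat, (0 < k <= m)%N & lam i = k%:R.
Hypothesis lam_max : exists i, lam i = m%:R.

Lemma qcol_spectral (s : seq algC) y x :
  qcol s y x = \sum_i phi i x * (phi i y)^* * \prod_(j <- s) (lam i - j).
Proof.
elim: s x => [|j s IHs] x /=.
  by rewrite -phi_cols; apply: eq_bigr => i _; rewrite big_nil mulr1.
rewrite (eq_qop IHs) qop_sum IHs mulr_sumr -sumrB; apply: eq_bigr => i _.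
rewrite big_cons /=.
have -> : qop (fun z => phi i z * (phi i y)^* * \prod_(j <- s) (lam i - j)) x =
  (phi i y)^* * \prod_(j <- s) (lam i - j) * qop (phi i) x.
  by rewrite -qopZ; apply: eq_qop => z; ring.
rewrite phi_eigen; ring.
Qed.

Lemma eigenbasis_expansion (u : G -> algC) x :
  u x = \sum_i (\sum_y u y * (phi i y)^* ) * phi i x.
Proof.
under eq_bigr do rewrite mulr_suml.
rewrite exchange_big /= (bigD1 x) //= [X in _ + X]big1 ?addr0.
  under eq_bigr do rewrite -mulrA [_^* * _]mulrC.
  by rewrite -mulr_sumr phi_cols eqxx mulr1.
move=> y yx; under eq_bigr do rewrite -mulrA [_^* * _]mulrC.
by rewrite -mulr_sumr phi_cols eq_sym (negPf yx) mulr0.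
Qed.

Lemma qform_spectral (u : G -> algC) (c : algC) :
  \sum_x (c * u x - qop u x) * (u x)^* =
  \sum_i (c - lam i) * `|\sum_x (u x)^* * phi i x| ^+ 2.
Proof.
pose al i := \sum_x u x * (phi i x)^*.
have uE x : u x = \sum_i al i * phi i x by exact: eigenbasis_expansion.
have quE x : qop u x = \sum_i lam i * al i * phi i x.
  rewrite (eq_qop uE) qop_sum; apply: eq_bigr => i _.
  by rewrite qopZ phi_eigen mulrCA mulrA.
have termE x : (c * u x - qop u x) * (u x)^* =
    \sum_i (c - lam i) * al i * ((u x)^* * phi i x).
  rewrite quE {1}uE mulr_sumr -sumrB mulr_suml.
  by apply: eq_bigr => i _; ring.
rewrite (eq_bigr _ (fun x _ => termE x)).
rewrite exchange_big /=; apply: eq_bigr => i _.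
rewrite -mulr_sumr -mulrA normCK; congr (_ * _).
rewrite [LHS]mulrC; congr (_ * _).
by rewrite /al rmorph_sum; apply: eq_bigr => x _; rewrite rmorphM /= conjCK.
Qed.

                                                                       
(** Put w = |u|. The triangle inequality gives m w <= Q w pointwise, while m - Q is positive
    semidefinite. So the form of m - Q at w is both nonpositive and nonnegative, hence zero, and w
    has no component outside the eigenspace of m. *)
Lemma max_eigenvector_norm (u : G -> algC) :
  qop u =1 (fun x => m%:R * u x) ->
  qop (fun x => `|u x|) =1 (fun x => m%:R * `|u x|).
Proof.
move=> uQ; pose w x := `|u x|.
have w_real x : (w x)^* = w x by rewrite conj_normC.
have lam_le i : 0 <= m%:R - lam i.
  by have [k /andP[_ km] ->] := lam_range i; rewrite subr_ge0 ler_nat.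
have sub_w x : m%:R * w x - qop w x <= 0.
  rewrite subr_le0 /w -[X in X * _]normr_nat -normrM -uQ /qop.
  rewrite (le_trans (ler_normD _ _)) // normrM normr_nat lerD2l.
  exact: ler_norm_sum.
have term_le0 x : (m%:R * w x - qop w x) * (w x)^* <= 0.
  by rewrite w_real mulr_le0_ge0 ?normr_ge0.
have sum0 : \sum_x (m%:R * w x - qop w x) * (w x)^* = 0.
  apply/eqP; rewrite eq_le; apply/andP; split; first exact: sumr_le0.
  rewrite qform_spectral sumr_ge0 // => i _.
  by rewrite mulr_ge0 ?exprn_ge0.
have al0 i : (m%:R - lam i) * (\sum_x (w x)^* * phi i x) = 0.
  have := qform_spectral w m%:R; rewrite sum0 => /esym/eqP.
  rewrite psumr_eq0 => [|j _]; last by rewrite mulr_ge0 ?exprn_ge0.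
  move/allP/(_ i (mem_index_enum _)); rewrite implyTb mulf_eq0.
  case/orP => [/eqP->|]; first by rewrite mul0r.
  by rewrite expf_eq0 normr_eq0 => /eqP->; rewrite mulr0.
have wE := eigenbasis_expansion w.
move=> x; apply/esym/eqP; rewrite -subr_eq0 -/(w x) {1}wE.
rewrite (eq_qop wE) qop_sum mulr_sumr -sumrB big1 // => i _.
rewrite qopZ phi_eigen.
have /(congr1 (fun z => z^*)) := al0 i.
rewrite rmorphM rmorphB rmorph0 rmorph_sum /= conjC_nat.
have -> : (lam i)^* = lam i by have [k _ ->] := lam_range i; rewrite conjC_nat.
under eq_bigr do rewrite rmorphM /= conjCK.
by move=> al0i; rewrite mulrCA -mulrBr -mulrBl mulrCA mulrA al0i mul0r.
Qed.

(** By the previous lemma |u| is a nonnegative eigenvector. At a zero of it the eigenvalue equation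
    says that the values at the neighbours sum to zero, so zeros spread along edges. This is the
    simplicity of the eigenvalue m in usable form. *)
Lemma max_eigenvector_eq0 (u : G -> algC) r :
  qop u =1 (fun x => m%:R * u x) -> u r = 0 -> u =1 (fun=> 0).
Proof.
move=> /max_eigenvector_norm uQ ur x.
have step y z : u y = 0 -> adj y z -> u z = 0.
  move=> uy yz; have /eqP := uQ y; rewrite /qop uy normr0 !mulr0 add0r.
  rewrite psumr_eq0 // => /allP/(_ z (mem_index_enum _)).
  by rewrite yz normr_eq0 => /eqP.
have /connectP[p rp ->] := Gconn.2 r x.
elim: p r ur rp => [|y p IHp] r ur //= /andP[ry yp].
exact: IHp (step _ _ ur ry) yp.
Qed.

Lemma max_eigenvector_int_eq0 (u : G -> int) r :
  qop u =1 (fun x => m%:R * u x) -> u r = 0 -> u =1 (fun=> 0).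
Proof.
move=> uQ ur x; pose v y : algC := (u y)%:~R.
have vQ : qop v =1 (fun y => m%:R * v y).
  by move=> y; rewrite /v -qop_intr uQ rmorphM rmorph_nat.
have /eqP := max_eigenvector_eq0 vQ (congr1 _ ur) x.
by rewrite intr_eq0 => /eqP.
Qed.

Lemma qcol_sym (s : seq int) (x y : G) : qcol s y x = qcol s x y.
Proof.
apply/eqP; rewrite -(eqr_int algC) -[X in X == _](rmorph_int Num.conj).
rewrite !qcol_intr !qcol_spectral rmorph_sum; apply/eqP.
apply: eq_bigr => i _; rewrite !rmorphM /= conjCK.
rewrite [_^* * _]mulrC; congr (_ * _).
have [k _ ->] := lam_range i; rewrite rmorph_prod !big_map.
by apply: eq_bigr => j _; rewrite rmorphB /= conjC_nat rmorph_int.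
Qed.

Lemma qcol_diag_spectral (s : seq int) (x : G) :
  (qcol s x x)%:~R =
  \sum_i `|phi i x| ^+ 2 * \prod_(j <- s) (lam i - j%:~R).
Proof.
rewrite qcol_intr qcol_spectral; apply: eq_bigr => i _.
by rewrite normCK big_map.
Qed.

(** A diagonal entry of p(Q) is the combination of the values of p at the eigenvalues with weights
    |phi i x|^2, so a polynomial p that is nonnegative on {1, ..., m} has nonnegative diagonal
    entries at Q. *)
Lemma combination_ge0 (I : Type) (r : seq I) (c : I -> int) (s : I -> seq int) (x : G) :
  (forall k : nat, (0 < k <= m)%N ->
     0 <= \sum_(t <- r) c t * \prod_(j <- s t) (k%:Z - j)) ->
  0 <= \sum_(t <- r) c t * qcol (s t) x x.
Proof.
move=> c_ge0; rewrite -(ler0z algC) rmorph_sum /=.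
under eq_bigr do rewrite rmorphM /= qcol_diag_spectral mulr_sumr.
rewrite exchange_big /= sumr_ge0 // => i _.
have [k /c_ge0] := lam_range i; rewrite -(ler0z algC) => ge0 ->.
rewrite [X in 0 <= X](_ : _ = `|phi i x| ^+ 2 *
  (\sum_(t <- r) c t * \prod_(j <- s t) (k%:Z - j))%:~R).
  by rewrite mulr_ge0 ?exprn_ge0.
rewrite rmorph_sum mulr_sumr; apply: eq_bigr => t _.
rewrite rmorphM rmorph_prod mulrCA; congr (_ * (_ * _)).
by apply: eq_bigr => j _; rewrite rmorphB.
Qed.

Lemma prod_intr (k : nat) (s : seq int) :
  \prod_(j <- s) (k%:R - j%:~R) = (\prod_(j <- s) (k%:Z - j))%:~R :> algC.
Proof. by rewrite rmorph_prod; apply: eq_bigr => j _; rewrite rmorphB. Qed.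

                                                                       
                                                     
(** The numbers 1, ..., m - 1. The corresponding product M of the factors Q - j kills every
    eigenvector for an eigenvalue below m and acts as (m - 1)! on the eigenspace of m. *)
Definition shifts : seq int := [seq k%:Z | k <- iota 1 m.-1].

Lemma prod_shifts (k : nat) : (0 < k <= m)%N ->
  \prod_(j <- shifts) (k%:Z - j) = if k == m then (m.-1)`!%:Z else 0.
Proof.
case/andP=> k0 km; rewrite /shifts big_map; case: eqP => [kE|/eqP kNm].
  rewrite kE; have -> : iota 1 m.-1 = index_iota 1 m by rewrite /index_iota subn1.
  rewrite big_nat_rev /= fact_prod rmorph_prod /=.
  have mE : m = m.-1.+1 by rewrite prednK // -kE.
  rewrite [in RHS]/index_iota -mE; apply: eq_big_nat => i /andP[i1 im].
  by rewrite add1n subSS -subzn 1?ltnW // subKr.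
apply/eqP; rewrite prodf_seq_eq0; apply/hasP; exists k; last by rewrite subrr eqxx.
rewrite mem_iota k0 /=; lia.
Qed.

(** One more factor Q - m makes the polynomial vanish on the whole spectrum. *)
Lemma qop_shifts (y : G) : qop (qcol shifts y) =1 (fun x => m%:R * qcol shifts y x).
Proof.
move=> x; apply/eqP; rewrite -subr_eq0 -(intr_eq0 algC).
rewrite -[X in intmul 1 X]/(qcol (m%:R :: shifts) y x) qcol_intr qcol_spectral.
rewrite big1 // => i _; have [k k_range ->] := lam_range i.
rewrite big_map big_cons rmorph_nat.
rewrite (prod_intr k) prod_shifts //; case: eqP => [->|_].
  by rewrite subrr mul0r mulr0.
by rewrite rmorph0 !mulr0.
Qed.

(** The combination M r r * M x - M x r * M r of two rows is an eigenvector for m that vanishes at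
    r, hence it is zero. *)
Lemma shifts_rank1 (r x y : G) :
  qcol shifts x y * qcol shifts r r = qcol shifts r x * qcol shifts r y.
Proof.
pose u z := qcol shifts r r * qcol shifts x z - qcol shifts x r * qcol shifts r z.
have uQ : qop u =1 (fun z => m%:R * u z).
  by move=> z; rewrite /u qopB !qopZ !qop_shifts; ring.
have /(max_eigenvector_int_eq0 uQ)/(_ y)/eqP : u r = 0 by rewrite /u mulrC subrr.
by rewrite subr_eq0 mulrC => /eqP->; rewrite [qcol _ x r]qcol_sym.
Qed.

(** The entry is (m - 1)! times the sum of |phi i r|^2 over the indices with eigenvalue m. If it
    were zero, an eigenvector for m would vanish at r, hence everywhere, against its unit norm. *)
Lemma shifts_diag_gt0 (r : G) : 0 < qcol shifts r r.
Proof.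
rewrite lt_neqAle eq_sym -(ler0z algC) -(intr_eq0 algC) qcol_diag_spectral.
have term_ge0 i : 0 <= `|phi i r| ^+ 2 * \prod_(j <- shifts) (lam i - j%:~R).
  have [k k_range ->] := lam_range i; rewrite mulr_ge0 ?exprn_ge0 //.
  by rewrite (prod_intr k) prod_shifts // ler0z; case: ifP.
rewrite sumr_ge0 // andbT; have [i lam_i] := lam_max.
rewrite psumr_eq0 //; apply/allP => /(_ i (mem_index_enum _)).
rewrite implyTb lam_i mulf_eq0 expf_eq0 normr_eq0 /=.
have m0 : (0 < m)%N.
  have [k /andP[k0 km] _] := lam_range i; exact: leq_trans k0 km.
rewrite (prod_intr m) prod_shifts ?m0 ?leqnn // eqxx intr_eq0 eqz_nat gtn_eqF ?fact_gt0 // orbF.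
move/eqP/max_eigenvector_eq0 => phi0.
have := phi_rows i i; rewrite eqxx big1 => [/esym/eqP|x _]; first by rewrite oner_eq0.
by rewrite phi0 ?mul0r // => z; rewrite phi_eigen lam_i.
Qed.

(** For the row v of M at r, |v| - v is again an eigenvector for m, and it vanishes at r because v r
    > 0. So v = |v|, and v has no zero. *)
Lemma shifts_gt0 (r x : G) : 0 < qcol shifts r x.
Proof.
pose v z : algC := (qcol shifts r z)%:~R.
have vQ : qop v =1 (fun z => m%:R * v z).
  by move=> z; rewrite /v -qop_intr qop_shifts rmorphM rmorph_nat.
have nvQ := max_eigenvector_norm vQ.
have dQ : qop (fun z => `|v z| - v z) =1 (fun z => m%:R * (`|v z| - v z)).
  by move=> z; rewrite qopB nvQ vQ mulrBr.
have vr : 0 < v r by rewrite ltr0z shifts_diag_gt0.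
have /(max_eigenvector_eq0 dQ)/(_ x)/eqP : `|v r| - v r = 0.
  by rewrite gtr0_norm // subrr.
rewrite subr_eq0 => /eqP vx; rewrite -(ltr0z algC) -/(v x) -vx normr_gt0.
apply/eqP => vx0; have := max_eigenvector_eq0 vQ vx0 r.
by move/eqP; rewrite gt_eqF.
Qed.

(** This is the diagonal entry at r of M^2 = (m - 1)! M. *)
Lemma shifts_sqr (r : G) :
  \sum_x qcol shifts r x ^+ 2 = (m.-1)`!%:Z * qcol shifts r r.
Proof.
apply/eqP; rewrite -(eqr_int algC) rmorphM /= qcol_diag_spectral rmorph_sum /=.
have lamE i : \prod_(j <- shifts) (lam i - j%:~R) =
    (lam i == m%:R)%:R * (m.-1)`!%:R :> algC.
  have [k k_range ->] := lam_range i.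
  by rewrite (prod_intr k) prod_shifts // eqr_nat; case: eqP => _; rewrite ?mul1r ?mul0r.
have colE x : (qcol shifts r x)%:~R = \sum_i phi i x * (phi i r)^* *
    ((lam i == m%:R)%:R * (m.-1)`!%:R).
  by rewrite qcol_intr qcol_spectral; apply: eq_bigr => i _; rewrite big_map lamE.
(* The entry is an integer, so one of the two factors of its square may be written in conjugate
   form. The sum over x then becomes the orthonormality relation. *)
have colC x : (qcol shifts r x)%:~R = \sum_i (phi i x)^* * phi i r *
    ((lam i == m%:R)%:R * (m.-1)`!%:R).
  rewrite -(rmorph_int Num.conj) colE rmorph_sum; apply: eq_bigr => i _.
  by rewrite !rmorphM /= conjCK !conjC_nat.
apply/eqP; transitivity (\sum_x \sum_i \sum_j (phi i x * (phi j x)^* ) *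
   ((phi i r)^* * ((lam i == m%:R)%:R * (m.-1)`!%:R) *
    (phi j r * ((lam j == m%:R)%:R * (m.-1)`!%:R)))).
  apply: eq_bigr => x _; rewrite rmorphXn /= expr2 {1}colE colC mulr_suml.
  apply: eq_bigr => i _; rewrite mulr_sumr; apply: eq_bigr => j _; ring.
rewrite exchange_big /= mulr_sumr; apply: eq_bigr => i _.
rewrite exchange_big /= (bigD1 i) //= [X in _ + X]big1 ?addr0.
  rewrite -mulr_suml phi_rows eqxx mul1r lamE normCK.
  by rewrite -pmulrn; case: (lam i == _) => /=; ring.
move=> j ji; rewrite -mulr_suml phi_rows eq_sym (negPf ji) mul0r //.
Qed.

End Spectrum.

                                               

(** * Positivity of the spectrum in the non-bipartite case *)

Section Range.

Variable G : sgraph.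

(** The factor 2 appears because the right-hand side meets every edge from both ends. *)
Lemma qform_energy (u : G -> algC) :
  (\sum_x (u x)^* * qop u x) *+ 2 =
  \sum_x \sum_(y | adj x y) `|u x + u y| ^+ 2.
Proof.
have swap (f : G -> G -> algC) :
    \sum_x \sum_(y | adj x y) f x y = \sum_x \sum_(y | adj x y) f y x.
  under eq_bigr do rewrite big_mkcond.
  rewrite exchange_big; apply: eq_bigr => x _; rewrite [RHS]big_mkcond.
  by apply: eq_bigr => y _; rewrite adj_sym.
have -> : \sum_x (u x)^* * qop u x =
    \sum_x \sum_(y | adj x y) (u x)^* * (u x + u y).
  apply: eq_bigr => x _; rewrite -mulr_sumr big_split /=; congr (_ * (_ + _)).
  by rewrite sumr_const /degree mulr_natl; congr (_ *+ _); apply: eq_card => y; rewrite inE.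
rewrite mulr2n {2}swap -big_split; apply: eq_bigr => x _.
rewrite -big_split; apply: eq_bigr => y _ /=.
by rewrite normCK rmorphD /=; ring.
Qed.

(** If the energy of an eigenvector u vanished, u would change sign along every edge. By
    connectedness it would then take only the values u r and - u r, and the set where it equals u r
    would be one side of a bipartition. *)
Lemma eigenvalue_gt0 (c : algC) :
  connected G -> ~ bipartite G -> eigenvalue (signless_laplacian G) c -> 0 < c.
Proof.
move=> [_ Gconn] nbip /eigenvalue_signless_laplacianP[u uQ [r ur]].
have e_ge0 x y : 0 <= `|u x + u y| ^+ 2 by rewrite exprn_ge0.
have normE : (\sum_x (u x)^* * qop u x) *+ 2 = c * ((\sum_x `|u x| ^+ 2) *+ 2).
  rewrite mulrnAr mulr_sumr; congr (_ *+ 2); apply: eq_bigr => x _.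
  by rewrite uQ normCK; ring.
have norm_gt0 : 0 < (\sum_x `|u x| ^+ 2) *+ 2.
  rewrite pmulrn_lgt0 // (bigD1 r) //= ltr_wpDr ?exprn_gt0 ?normr_gt0 //.
  by apply: sumr_ge0 => x _; rewrite exprn_ge0.
rewrite -(pmulr_lgt0 _ norm_gt0) -normE qform_energy lt_neqAle.
rewrite [X in _ && X]sumr_ge0 ?andbT; last by move=> x _; rewrite sumr_ge0.
rewrite eq_sym; apply/eqP => sum0; apply: nbip.
have opp x y : adj x y -> u y = - u x.
  move=> xy; have /eqP := sum0; rewrite psumr_eq0; last by move=> z _; rewrite sumr_ge0.
  move/allP/(_ x (mem_index_enum _)); rewrite implyTb psumr_eq0 //.
  move/allP/(_ y (mem_index_enum _)); rewrite xy expf_eq0 normr_eq0 /= addrC.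
  by rewrite addr_eq0 => /eqP.
have pm x : (u x == u r) || (u x == - u r).
  have /connectP[p] := Gconn r x.
  have rr : (u r == u r) || (u r == - u r) by rewrite eqxx.
  suff step z : (u z == u r) || (u z == - u r) -> path (@adj G) z p ->
      x = last z p -> (u x == u r) || (u x == - u r) by exact: step.
  elim: p z => [|y p IHp] z zr /=; first by move=> _ ->.
  case/andP=> zy yp; apply: IHp yp.
  by rewrite (opp _ _ zy) eqr_oppLR eqr_opp orbC.
have ur2 : (u r == - u r) = false.
  apply/negP => /eqP /esym /eqP; rewrite -subr_eq0 -opprD oppr_eq0 -mulr2n.
  by rewrite mulrn_eq0 /= (negPf ur).
exists [set x | u x == u r] => x y xy; rewrite !inE (opp _ _ xy).
have := pm x; rewrite [- u x == _]eqr_oppLR; case: eqP => [->|_] /=; rewrite ?ur2 //.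
by move=> ->.
Qed.

End Range.

(** * Diagonal entries of the powers of Q *)

Section Moments.

Variable G : sgraph.

(** [q1] and [q2] are the entries of Q and Q^2; [q3] and [q4] are the diagonal entries of Q^3 and
    Q^4. By symmetry of Q^2 the latter two need only the row of Q^2 at x. *)
Definition q1 (x y : G) : nat := if x == y then degree x else adj x y.
Definition q2 (x y : G) : nat := (\sum_z q1 x z * q1 z y)%N.
Definition q3 (x : G) : nat := (\sum_z q1 x z * q2 x z)%N.
Definition q4 (x : G) : nat := (\sum_z q2 x z * q2 x z)%N.

Lemma q1_sym x y : q1 x y = q1 y x.
Proof. by rewrite /q1 eq_sym adj_sym; case: eqP => [->|]. Qed.

Lemma q2_sym x y : q2 x y = q2 y x.
Proof. by apply: eq_bigr => z _; rewrite mulnC !(q1_sym z). Qed.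

Lemma qopE (R : nzRingType) (u : G -> R) x : qop u x = \sum_y (q1 x y)%:R * u y.
Proof.
rewrite /qop [RHS](bigD1 x) //= /q1 eqxx; congr (_ + _).
rewrite big_mkcond /= (bigD1 x) //= adj_irrefl add0r.
apply: eq_bigr => y /negPf yx; rewrite eq_sym yx.
by case: adj; rewrite ?mul1r ?mul0r.
Qed.

Lemma qcol_q1 (x y : G) : qcol [:: 0 : int] y x = (q1 x y)%:Z.
Proof.
rewrite /= mul0r subr0 qopE (bigD1 y) //= eqxx mulr1 big1 ?addr0 ?natz // => z /negPf->.
by rewrite mulr0.
Qed.

Lemma qcol_q2 (x y : G) : qcol [:: 0 : int; 0] y x = (q2 x y)%:Z.
Proof.
rewrite [LHS]/= mul0r subr0 (eq_qop (fun x => qcol_q1 x y)) qopE /q2.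
rewrite -natz natr_sum; apply: eq_bigr => z _; by rewrite natrM !natz.
Qed.

Lemma qcol_q3 (x : G) : qcol [:: 0 : int; 0; 0] x x = (q3 x)%:Z.
Proof.
rewrite [LHS]/= mul0r subr0 (eq_qop (fun y => qcol_q2 y x)) qopE /q3.
rewrite -natz natr_sum; apply: eq_bigr => z _; by rewrite natrM !natz q2_sym.
Qed.

Lemma qcol_q4 (x : G) : qcol [:: 0 : int; 0; 0; 0] x x = (q4 x)%:Z.
Proof.
rewrite [LHS]/= mul0r subr0 qopE.
transitivity (\sum_z \sum_y (q1 x y * q1 y z * q2 x z)%:Z).
  rewrite exchange_big /=; apply: eq_bigr => y _.
  rewrite mul0r subr0 (eq_qop (fun z => qcol_q2 z x)) qopE mulr_sumr.
  by apply: eq_bigr => z _; rewrite mulrA !natz -!PoszM (q2_sym x).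
rewrite /q4 -natz natr_sum; apply: eq_bigr => z _.
rewrite natz {2}/q2 big_distrl /= -natz natr_sum.
by apply: eq_bigr => y _; rewrite natz.
Qed.

Lemma q2_diag x : q2 x x = (degree x * degree x + degree x)%N.
Proof.
rewrite /q2 (bigD1 x) //= /q1 eqxx; congr (_ + _)%N.
transitivity (\sum_(z | adj x z) 1)%N.
  rewrite [RHS]big_mkcond [RHS](bigD1 x) //= adj_irrefl add0n.
  apply: eq_bigr => z /negPf zx; rewrite eq_sym zx adj_sym.
  by case: adj.
by rewrite sum1_card; apply: eq_card => z; rewrite !inE.
Qed.

End Moments.

                                

(** * The arithmetic data extracted from the spectrum *)

Definition dot (R : pzRingType) (s t : seq R) : R :=
  foldr (fun p c => p.1 * p.2 + c) 0 (zip s t).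

                                                             
                                                                           
                                      
(** The first five coefficients are those of a polynomial of degree at most 4; the sixth is the
    multiple of the polynomial of M that is subtracted, whose value is (m - 1)! at m and 0 at 1,
    ..., m - 1. Validity means that the difference is nonnegative on {1, ..., m}. *)
Definition test_valid (m : nat) (t : seq int) :=
  (size t == 6%N) &&
  all (fun k : nat => 0 <= dot t [:: 1; k%:Z; k%:Z ^+ 2; k%:Z ^+ 3; k%:Z ^+ 4;
                                 - (if k == m then (m.-1)`! else 0)%:Z])
      (iota 1 m).

                                                                              
                                                               
(** The interface between spectral theory and search, free of algebraic numbers: [a] is the row of M
    at [r], and the number [e] of [cert_tests] is the diagonal entry of M at [x]. The tie-break on
    degrees in [cert_max] cuts down the labels that the search must consider. *)
Record certificate (G : sgraph) (m : nat) (r : G) (a : G -> nat) : Prop := {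
  cert_m : (m <= 6)%N;
  cert_conn : connected G;
  cert_gt0 : forall x : G, (0 < a x)%N;
  cert_eigen : forall x : G,
    (degree x * a x + \sum_(y | adj x y) a y = m * a x)%N;
  cert_degree : forall x : G, (1 < degree x)%N /\ (degree x + 2 <= m)%N;
  cert_total : (\sum_(x : G) a x ^ 2 = (m.-1)`! * a r)%N;
  cert_max : forall x : G, (a x < a r)%N || (a x == a r) && (degree x <= degree r)%N;
  cert_rank1 : forall x y : G, qcol (shifts m) y x * (a r)%:Z = (a x * a y)%:Z;
  cert_tests : forall x : G, exists2 e : nat, (e * a r = a x ^ 2)%N &
    forall t, test_valid m t ->
    0 <= dot t [:: 1; (degree x)%:Z; (degree x * degree x + degree x)%N%:Z;
                  (q3 x)%:Z; (q4 x)%:Z; - e%:Z]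
}.

(** The geometric mean c of a and b lies between them. It is applied to a = M x x, b = M r r and c =
    M r x, so that maximality of the diagonal at r passes to the row at r. *)
Lemma lex_max_geometric_mean (a b c k l : nat) :
  (a * b = c * c -> 0 < b -> (a < b) || (a == b) && (k <= l) ->
   (c < b) || (c == b) && (k <= l))%N.
Proof.
move=> abc b0 /orP[ab|/andP[/eqP ab kl]].
  by rewrite -(ltn_sqr c) -!mulnn -abc ltn_pmul2r ?ab.
by rewrite kl -(eqn_sqr c) -!mulnn -abc ab eqxx orbT.
Qed.

Lemma certificate_exists (G : sgraph) (mu : algC) :
  connected G -> ~ bipartite G -> Q_integral G -> Q_spectral_radius G mu ->
  mu <= 6 -> exists m r a, @certificate G m r a.
Proof.
move=> Gconn nbip Gint [mu_eigen mu_max] mu6.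
have [phi [lam [lam_eigen phiE phi_cols phi_rows]]] := signless_laplacian_eigenbasis G.
have nat_eigen c : eigenvalue (signless_laplacian G) c ->
    exists2 k : nat, (0 < k)%N & c = k%:R.
  move=> c_eigen; have c0 := eigenvalue_gt0 Gconn nbip c_eigen.
  have /natrP[k kE] : c \is a Num.nat by rewrite natrEint Gint //= ltW.
  by exists k; rewrite // lt0n -(pnatr_eq0 algC) -kE gt_eqF.
have [m m0 muE] := nat_eigen _ mu_eigen; rewrite {}muE in mu_eigen mu_max mu6.
have lam_range i : exists2 k : nat, (0 < k <= m)%N & lam i = k%:R.
  have [k k0 lamE] := nat_eigen _ (lam_eigen i); exists k => //.
  by rewrite k0 -(ler_nat algC) -lamE mu_max.
(* An eigenvector for m has a nonzero coefficient [al i] in the eigenbasis. The form of m - Q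
   vanishes at it and is a sum of nonnegative terms, so the term at i gives [lam i] = m. *)
have lam_max : exists i, lam i = m%:R.
  have /eigenvalue_signless_laplacianP[u uQ [x ux]] := mu_eigen.
  pose al i := \sum_y u y * (phi i y)^*.
  have uE := eigenbasis_expansion phi_cols u.
  have [i al_i] : exists i, al i != 0.
    apply/existsP; apply: contraT; rewrite negb_exists => /forallP al0.
    move: ux; rewrite uE big1 ?eqxx // => i _.
    by have := al0 i; rewrite negbK => /eqP; rewrite /al => ->; rewrite mul0r.
  exists i; apply/eqP; rewrite -subr_eq0; apply/eqP/(mulIf al_i); rewrite mul0r.
  have := qform_spectral phiE phi_cols u m%:R; rewrite big1; last first.
    by move=> y _; rewrite uQ subrr mul0r.
  move/esym/eqP; rewrite psumr_eq0 => [|j _]; last first.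
    have [k /andP[_ km] ->] := lam_range j.
    by rewrite mulr_ge0 ?exprn_ge0 // subr_ge0 ler_nat.
  move/allP/(_ i (mem_index_enum _)); rewrite implyTb mulf_eq0 expf_eq0 normr_eq0 /=.
  have -> : \sum_y (u y)^* * phi i y = (al i)^*.
    by rewrite rmorph_sum; apply: eq_bigr => y _; rewrite rmorphM /= conjCK.
  rewrite conjC_eq0 (negPf al_i) orbF subr_eq0 => /eqP->.
  by rewrite subrr mul0r.
pose M (x y : G) : nat := `|qcol (shifts m) y x|%N.
have ME (x y : G) : qcol (shifts m) y x = (M x y)%:Z.
  rewrite /M gez0_abs // ltW //.
  exact: (shifts_gt0 Gconn phiE phi_cols phi_rows lam_range lam_max).
have Msym (x y : G) : M x y = M y x.
  by rewrite /M (qcol_sym phiE phi_cols lam_range).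
have rank1 (r x y : G) : (M y x * M r r = M x r * M y r)%N.
  have := shifts_rank1 Gconn phiE phi_cols lam_range r x y.
  by rewrite !ME -!PoszM => -[->].
have [x0 _] : exists x : G, x \in G by apply/card_gt0P; case: Gconn.
                                                                   
(* All degrees are below 6, so this key orders vertices lexicographically by diagonal entry of M and
   then by degree. *)
pose key (x : G) := (M x x * 6 + degree x)%N.
case: (arg_maxnP key (isT : xpredT x0)) => r _ key_max.
exists m, r, (M r).
have m6 : (m <= 6)%N by rewrite -(ler_nat algC).
(* The polynomial -(k - 1)(k - m) is nonnegative on {1, ..., m}. With d = degree x its diagonal
   entry at Q yields d^2 - m d + m <= 0, which fails for d <= 1 and for d >= m - 1. *)
have deg_range (x : G) : (1 < degree x)%N /\ (degree x + 2 <= m)%N.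
  have := @combination_ge0 _ _ _ _ phiE phi_cols lam_range
    unit [:: tt] (fun=> -1) (fun=> [:: 1; m%:Z]) x.
  rewrite !big_seq1.
  have -> : qcol [:: 1; m%:Z] x x =
      ((degree x)%:Z - 1) * ((degree x)%:Z - m%:Z) + (degree x)%:Z.
    have E z : qcol [:: m%:Z] x z = (q1 x z)%:Z - m%:Z * (z == x)%:R.
      by rewrite q1_sym -qcol_q1 /= mul0r subr0.
    have E2 : \sum_y (q1 x y)%:R * qcol [:: m%:Z] x y =
        (q2 x x)%:Z - m%:Z * (degree x)%:Z.
      rewrite (eq_bigr (fun y => (q1 x y * q1 y x)%:Z - m%:Z * ((q1 x y)%:Z * (y == x)%:R))).
        rewrite sumrB -mulr_sumr; congr (_ - _ * _).
          by rewrite /q2 -natz natr_sum; apply: eq_bigr => y _; rewrite natz.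
        rewrite (bigD1 x) //= eqxx mulr1 big1 ?addr0 /q1 ?eqxx //.
        by move=> y /negPf->; rewrite mulr0.
      by move=> y _; rewrite E (q1_sym y) natz PoszM; ring.
    rewrite [LHS](_ : _ = qop (qcol [:: m%:Z] x) x - 1 * qcol [:: m%:Z] x x) //.
    by rewrite qopE E2 E q2_diag /q1 !eqxx; lia.
  move=> deg_ge0.
  have {}deg_ge0 : 0 <= -1 * (((degree x)%:Z - 1) * ((degree x)%:Z - m%:Z) + (degree x)%:Z).
    apply: deg_ge0 => k /andP[k0 km]; rewrite big_seq1 !big_cons big_nil; nia.
  have d1 : (1 < degree x)%N by nia.
  by split; last nia.
split => //.
- by move=> x; rewrite -ltz_nat -ME (shifts_gt0 Gconn phiE phi_cols phi_rows lam_range lam_max).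
- move=> x; apply/eqP; rewrite -eqz_nat !(PoszD, PoszM) Msym -ME.
  have /(_ x) := qop_shifts phiE phi_cols lam_range r; rewrite natz => <-.
  rewrite /qop ME natz; apply/eqP; congr (_ + _).
  by rewrite -natz natr_sum; apply: eq_bigr => y _; rewrite natz ME Msym.
- apply/eqP; rewrite -eqz_nat PoszM -ME.
  rewrite -(shifts_sqr phiE phi_cols phi_rows lam_range) -natz natr_sum.
  by apply/eqP; apply: eq_bigr => x _; rewrite natz ME Msym; lia.
- move=> x; have r_gt0 : (0 < M r r)%N.
    by rewrite -ltz_nat -ME (shifts_diag_gt0 Gconn phiE phi_cols phi_rows lam_range lam_max).
  have := rank1 r x x; rewrite (Msym r x) => /lex_max_geometric_mean; apply=> //.
  have := key_max x isT; rewrite /key.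
  have [_ dx] := deg_range x; have [_ dr] := deg_range r.
  have : (degree x < 6)%N by lia.
  have : (degree r < 6)%N by lia.
  by move: (M x x) (M r r) => A B; lia.
- by move=> x y; rewrite ME -PoszM rank1 mulnC !(Msym r).
move=> x; exists (M x x); first by rewrite rank1 mulnn Msym.
move=> t /andP[/eqP st /allP t_ok].
case: t st t_ok => [|c0 [|c1 [|c2 [|c3 [|c4 [|c5 []]]]]]] //= _ t_ok.
(* A list of j zeros stands for Q^j, and [shifts m] stands for M. *)
pose cs := [:: (c0, [::]); (c1, [:: 0]); (c2, [:: 0; 0]); (c3, [:: 0; 0; 0]);
  (c4, [:: 0; 0; 0; 0]); (- c5, shifts m)] : seq (int * seq int).
have := @combination_ge0 _ _ _ _ phiE phi_cols lam_range _ cs fst snd x.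
rewrite /cs !big_cons !big_nil /fst /snd.
rewrite qcol_q1 qcol_q2 qcol_q3 qcol_q4 ME q2_diag /q1 eqxx.
rewrite (_ : qcol [::] x x = 1); last by rewrite /= eqxx.
move=> cs_ge0; have {}cs_ge0 := cs_ge0 _; rewrite /dot /=.
apply: le_trans (cs_ge0 _) _; last by rewrite le_eqVlt; apply/orP; left; apply/eqP; ring.
move=> k k_range; rewrite !big_cons !big_nil prod_shifts //.
have := t_ok k; rewrite mem_iota add1n ltnS => /(_ k_range); rewrite /dot /=.
move/le_trans; apply; rewrite le_eqVlt; apply/orP; left; apply/eqP.
by case: (k == m); rewrite ?subr0; ring.
Qed.

                          

(** * The exhaustive search over labelled graphs *)

Section Search.
Local Open Scope nat_scope.

                                                                               
                                                             
(** Multisets of c labels from [L] of total weight w, each listed with equal labels grouped in the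
    order of [L]: new vertices are interchangeable, so their order is immaterial. The cut
    [w <= c * l.1] is sound because [L] is sorted by decreasing weight. *)
Fixpoint fresh (L : seq (nat * nat)) (c w : nat) : seq (seq (nat * nat)) :=
  if c == 0 then (if w == 0 then [:: [::]] else [::])
  else if L is l :: L' then
    if w <= c * l.1 then
      flatten [seq [seq nseq k l ++ s | s <- fresh L' (c - k) (w - k * l.1)]
              | k <- iota 0 c.+1 & k * l.1 <= w]
    else [::]
  else [::].

Definition label (labs : seq (nat * nat)) (i : nat) := nth (0, 0) labs i.
Definition row (rows : seq (seq nat)) (i : nat) := nth [::] rows i.
Definition known (rows : seq (seq nat)) j :=
  [seq i <- iota 0 (size rows) | j \in row rows i].
Definition weight labs (s : seq nat) := sumn [seq (label labs j).1 | j <- s].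

                                                                                
                                                      
(** Choices of neighbours among the discovered vertices [js]. The pair returned with each choice is
    the number and the weight of the neighbours still to be created. *)
Fixpoint picks labs (js : seq nat) (c w : nat) : seq (seq nat * (nat * nat)) :=
  if js is j :: js' then
    picks labs js' c w ++
    (if (0 < c) && ((label labs j).1 <= w) then
       [seq (j :: p.1, p.2) | p <- picks labs js' c.-1 (w - (label labs j).1)]
     else [::])
  else [:: ([::], (c, w))].

                                                                              
                                                                                
Definition entry labs rows (y z : nat) : nat :=
  if y == z then (label labs y).2 else z \in row rows y.

Definition entry2 labs rows x z : nat :=
  (label labs x).2 * entry labs rows x z +
  sumn [seq entry labs rows y z | y <- row rows x].

Definition dotZ (s t : seq Z) : Z :=
  foldr (fun p c => Z.add (Z.mul p.1 p.2) c) Z0 (zip s t).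

(** The moments up to the fourth at x are determined once the rows of x and of all its neighbours
    are known; before that the test accepts. *)
Definition local_test er tests labs rows x :=
  let: (a, d) := label labs x in
  let r := row rows x in
  if all (fun y => y < size rows) (x :: r) then
    let v := [seq entry2 labs rows x z | z <- iota 0 (size labs)] in
    let m3 := d * nth 0 v x + sumn [seq nth 0 v y | y <- r] in
    let m4 := sumn [seq q * q | q <- v] in
    let e := Z.div (Z.mul (Z.of_nat a) (Z.of_nat a)) (Z.of_nat er) in
    let v := [:: Zpos xH; Z.of_nat d; Z.of_nat (d * d + d);
                 Z.of_nat m3; Z.of_nat m4; Z.opp e] in
    all (fun t => Z.leb Z0 (dotZ t v)) tests
  else true.

(** The Perron equation at j fixes the total weight of its neighbours as (m - d) * a. The missing
    neighbours each contribute between 1 and the maximum [er]. *)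
Definition degree_test m er labs rows j :=
  let: (a, d) := label labs j in
  if j < size rows then true else
  let kn := known rows j in
  let w := weight labs kn in
  [&& size kn <= d, d - size kn + w <= (m - d) * a
    & (m - d) * a <= (d - size kn) * er + w].

Definition budget_test (b : Z) (labs : seq (nat * nat)) :=
  Z.leb (foldr (fun l s => Z.add (Z.mul (Z.of_nat l.1) (Z.of_nat l.1)) s) Z0 labs) b.

                                                                                 
                                                                              
                                                                              
                                                                   
                                                                             
                                             
(** Vertices are numbered in order of discovery, and each step completes the neighbourhood of the
    first vertex without a row: earlier neighbours are forced, later discovered ones are picked, the
    rest are fresh. Only vertex k and its neighbours can become testable through row k. The nested
    conditionals keep call-by-value evaluation from running later tests after a failure. Exhausted
    fuel returns false, so a successful run proves that the fuel was sufficient. *)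
Fixpoint search final m er b L tests fuel labs rows : bool :=
  if fuel is f.+1 then
  let k := size rows in
  let n := size labs in
  if k == n then final labs rows else
  let: (a, d) := label labs k in
  let kn := known rows k in
  all (fun p => all (fun fr =>
      let labs' := labs ++ fr in
      let row' := (kn ++ p.1) ++ iota n (size fr) in
      let rows' := rcons rows row' in
      if (if budget_test b labs' then
            if all (degree_test m er labs' rows') row' then
              all (local_test er tests labs' rows') (k :: row')
            else false
          else false)
      then search final m er b L tests f labs' rows' else true)
    (fresh L p.2.1 p.2.2))
   (picks labs (iota k.+1 (n - k.+1)) (d - size kn) ((m - d) * a - weight labs kn))
  else false.

Lemma fresh_complete L c w s :
  pairwise (fun l l' : nat * nat => l'.1 <= l.1) L -> {subset s <= L} -> size s = c ->
  sumn [seq l.1 | l <- s] = w -> exists2 s', perm_eq s s' & s' \in fresh L c w.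
Proof.
elim: L c w s => [|l L IHL] c w s.
  case: s => [_ _ <- <-|l s _ /(_ l)]; first by exists [::].
  by rewrite mem_head => /(_ isT).
case/andP=> lL pwL sL sz sw; have [c0|c0] := eqVneq c 0.
  by move: sz sw; rewrite c0; case: s {sL} => // _ <-; exists [::].
have -> : fresh (l :: L) c w = if w <= c * l.1 then
    flatten [seq [seq nseq k l ++ s | s <- fresh L (c - k) (w - k * l.1)]
            | k <- iota 0 c.+1 & k * l.1 <= w] else [::] by case: c c0 {sz}.
have le_l x : x \in s -> x.1 <= l.1.
  by move=> /sL; rewrite inE => /predU1P[->//|xL]; exact: (allP lL).
have -> : w <= c * l.1.
  rewrite -sw -sz; elim: s le_l {sL sz sw} => //= x s IHs le_l.
  rewrite mulSn leq_add ?le_l ?mem_head // IHs // => y ys.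
  by rewrite le_l // inE ys orbT.
(* Moving the copies of [l] to the front reaches the grouped order that [fresh] enumerates. *)
pose k := count_mem l s; pose s2 := [seq x <- s | x != l].
have s_perm : perm_eq s (nseq k l ++ s2).
  rewrite perm_sym; apply: perm_trans (_ : perm_eq ([seq x <- s | x == l] ++ s2) s).
    rewrite perm_cat2r; have /all_pred1P -> := filter_all (pred1 l) s.
    by rewrite size_filter.
  by rewrite perm_filterC.
have s2L : {subset s2 <= L}.
  by move=> x; rewrite mem_filter => /andP[/negPf xl /sL]; rewrite inE xl.
have sz2 : size s2 = c - k.
  by rewrite -sz (perm_size s_perm) size_cat size_nseq addKn.
have swE : w = k * l.1 + sumn [seq x.1 | x <- s2].
  rewrite -sw (perm_sumn (perm_map _ s_perm)) map_cat sumn_cat map_nseq sumn_nseq.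
  by rewrite mulnC.
have [|s2' s2_perm s2_in] := IHL _ (w - k * l.1) _ pwL s2L sz2; first by rewrite swE addKn.
exists (nseq k l ++ s2'); first by rewrite (perm_trans s_perm) // perm_cat2l.
apply/flatten_mapP; exists k; last exact: map_f.
rewrite mem_filter swE leq_addr mem_iota /= add0n ltnS -sz.
exact: count_size.
Qed.

Lemma picks_complete labs (P : pred nat) js c w :
  size (filter P js) <= c -> weight labs (filter P js) <= w ->
  (filter P js, (c - size (filter P js), w - weight labs (filter P js)))
    \in picks labs js c w.
Proof.
elim: js c w => [|j js IHjs] c w /=; first by rewrite !subn0 inE.
case: ifP => _ /= sz sw; rewrite mem_cat; last by rewrite IHjs.
rewrite /weight /= in sw *; apply/orP; right.
have c0 : 0 < c by exact: leq_ltn_trans sz.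
have jw : (label labs j).1 <= w by exact: leq_trans (leq_addr _ _) sw.
rewrite c0 jw /=; apply/mapP.
exists (filter P js, (c.-1 - size (filter P js),
  w - (label labs j).1 - weight labs (filter P js))).
  by apply: IHjs; rewrite /weight; lia.
by rewrite /= /weight; congr (_, (_, _)); lia.
Qed.

End Search.

                                

(** * The given graph follows a branch of the search *)

Section Soundness.
Local Open Scope nat_scope.

Variables (G : sgraph) (m : nat) (r : G) (a : G -> nat).
Hypothesis cert : certificate m r a.

Definition vlabel (x : G) : nat * nat := (a x, degree x).

(** A search state realised inside the graph: [vs] lists the vertices discovered so far, and each
    row present is the complete neighbourhood of its vertex, given by positions in [vs]. *)
Record partial_copy (vs : seq G) (rows : seq (seq nat)) : Prop := {
  copy_root : vs != [::] /\ nth r vs 0 = r;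
  copy_uniq : uniq vs;
  copy_size : size rows <= size vs;
  copy_row_uniq : forall k, k < size rows -> uniq (row rows k);
  copy_row_bound : forall k, k < size rows -> {in row rows k, forall j, j < size vs};
  copy_row_adj : forall k, k < size rows ->
    adj (nth r vs k) =i [seq nth r vs j | j <- row rows k]
}.

Section Copy.

Variables (vs : seq G) (rows : seq (seq nat)).
Hypothesis copy : partial_copy vs rows.
Let labs := map vlabel vs.
Let v := nth r vs.

Lemma label_copy j : j < size vs -> label labs j = vlabel (v j).
Proof. by move=> jn; rewrite /label (nth_map r). Qed.

Lemma mem_row k j : k < size rows -> j < size vs ->
  (j \in row rows k) = adj (v k) (v j).
Proof.
move=> kr jn; rewrite -[RHS]/(v j \in adj (v k)) (copy_row_adj copy kr).
apply/idP/mapP => [jk|[i ik /eqP]]; first by exists j.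
by rewrite nth_uniq ?(copy_uniq copy) ?(copy_row_bound copy kr ik) // => /eqP->.
Qed.

Lemma map_row_uniq k : k < size rows -> uniq (map v (row rows k)).
Proof.
move=> kr; rewrite map_inj_in_uniq ?(copy_row_uniq copy) // => i j ik jk /eqP.
rewrite nth_uniq ?(copy_uniq copy) ?(copy_row_bound copy kr ik) //.
  by move/eqP.
exact: (copy_row_bound copy kr jk).
Qed.

Lemma sum_row (R : nmodType) (F : G -> R) k : k < size rows ->
  (\sum_(y | adj (v k) y) F y = \sum_(j <- row rows k) F (v j))%R.
Proof.
move=> kr; rewrite -(big_map v xpredT) big_uniq ?map_row_uniq //.
by apply: eq_bigl => y; rewrite -(copy_row_adj copy kr).
Qed.

Lemma degree_row k : k < size rows -> degree (v k) = size (row rows k).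
Proof.
move=> kr; rewrite -(size_map v) -(card_uniqP (map_row_uniq kr)).
by apply: eq_card => y; rewrite inE -(copy_row_adj copy kr).
Qed.

Lemma known_copy j : j < size vs ->
  known rows j = [seq i <- iota 0 (size rows) | adj (v j) (v i)].
Proof.
move=> jn; apply: eq_in_filter => i; rewrite mem_iota /= add0n => ir.
by rewrite mem_row // adj_sym.
Qed.

Lemma weight_copy s : {in s, forall j, j < size vs} ->
  weight labs s = \sum_(j <- s) a (v j).
Proof.
move=> sn; rewrite /weight sumnE big_map.
by apply: eq_big_seq => j js; rewrite label_copy ?sn.
Qed.

Lemma entry_copy y z : y < size rows -> z < size vs ->
  entry labs rows y z = q1 (v y) (v z).
Proof.
move=> yr zn; have yn := leq_trans yr (copy_size copy).
by rewrite /entry /q1 nth_uniq ?(copy_uniq copy) // label_copy // mem_row.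
Qed.

Lemma sum_q1 (F : G -> nat) x :
  \sum_z q1 x z * F z = degree x * F x + \sum_(z | adj x z) F z.
Proof.
rewrite (bigD1 x) //= /q1 eqxx; congr (_ + _).
rewrite [RHS]big_mkcond [RHS](bigD1 x) //= adj_irrefl add0n.
apply: eq_bigr => z /negPf zx; rewrite eq_sym zx.
by case: adj; rewrite ?mul1n ?mul0n.
Qed.

Lemma entry2_copy x z : x < size rows -> z < size vs ->
  {in row rows x, forall y, y < size rows} ->
  entry2 labs rows x z = q2 (v x) (v z).
Proof.
move=> xr zn xrow; have xn := leq_trans xr (copy_size copy).
rewrite /entry2 entry_copy // label_copy //= /q2 sum_q1; congr (_ + _).
rewrite (sum_row _ xr) sumnE big_map.
by apply: eq_big_seq => y yx; rewrite entry_copy ?xrow.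
Qed.

(** Two steps from x cannot leave [vs] when x and all its neighbours have rows. Hence the sum
    defining [q4] may be restricted to [vs]. *)
Lemma q2_outside x z : x < size rows ->
  {in row rows x, forall y, y < size rows} -> z \notin vs -> q2 (v x) z = 0.
Proof.
move=> xr xrow zvs.
have out y : y < size rows -> q1 (v y) z = 0.
  move=> yr; have yn := leq_trans yr (copy_size copy).
  have vy : v y \in vs by exact: mem_nth.
  rewrite /q1; case: eqP => [yz|_]; first by rewrite -yz vy in zvs.
  case yz: adj => //; have := copy_row_adj copy yr z.
  rewrite [in LHS]/in_mem /= yz => /esym/mapP[j jy zE].
  by rewrite zE mem_nth ?(copy_row_bound copy yr jy) in zvs.
rewrite /q2 sum_q1 out // muln0 (sum_row _ xr) big_seq big1 // => y yx.
by rewrite out ?xrow.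
Qed.

Lemma budget_test_copy : budget_test (Z.of_nat ((m.-1)`! * a r)) labs.
Proof.
have sqE (s : seq G) :
    foldr (fun l s => Z.add (Z.mul (Z.of_nat l.1) (Z.of_nat l.1)) s) Z0 (map vlabel s) =
    Z.of_nat (\sum_(x <- s) a x ^ 2).
  by elim: s => [|x s IHs] /=; rewrite ?big_nil // big_cons IHs; lia.
have sum_le : \sum_(x <- vs) a x ^ 2 <= (m.-1)`! * a r.
  rewrite -(cert_total cert) big_uniq ?(copy_uniq copy) //=.
  by rewrite [X in _ <= X](bigID [in vs]) /= leq_addr.
by rewrite /budget_test sqE; apply/Z.leb_le/(proj1 (Nat2Z.inj_le _ _))/ssrnat.leP.
Qed.

Lemma degree_test_copy j : j < size vs -> degree_test m (a r) labs rows j.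
Proof.
move=> jn; rewrite /degree_test label_copy //=; case: ltnP => // _.
set kn := known rows j.
have knE : kn = [seq i <- iota 0 (size rows) | adj (v j) (v i)] by exact: known_copy.
have kn_lt : {in kn, forall i, i < size vs}.
  move=> i; rewrite knE mem_filter mem_iota /= add0n => /andP[_ ir].
  exact: leq_trans ir (copy_size copy).
pose N := [set y | adj (v j) y]; pose K := [set y in map v kn].
have K_uniq : uniq (map v kn).
  rewrite map_inj_in_uniq ?knE ?filter_uniq ?iota_uniq // => i i'.
  rewrite -knE => ik ik' /eqP; rewrite nth_uniq ?(copy_uniq copy) ?kn_lt //.
  by move/eqP.
have KN : K \subset N.
  apply/subsetP => y; rewrite !inE => /mapP[i].
  by rewrite knE mem_filter => /andP[ji _] ->.
have KE : #|K| = size kn.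
  by rewrite cardsE (card_uniqP K_uniq) size_map.
have sumK : \sum_(y in K) a y = weight labs kn.
  rewrite weight_copy // -(big_map v xpredT) big_uniq //.
  by apply: eq_bigl => y; rewrite inE.
have DE : #|N :\: K| = degree (v j) - size kn by rewrite cardsD (setIidPr KN) KE.
have KNle : size kn <= degree (v j) by rewrite -KE subset_leq_card.
have eigen : (m - degree (v j)) * a (v j) = weight labs kn + \sum_(y in N :\: K) a y.
  rewrite mulnBl -(cert_eigen cert) addKn -sumK.
  rewrite (eq_bigl [in N]); last by move=> y; rewrite inE.
  by rewrite (big_setID K) /= (setIidPr KN).
have lower : degree (v j) - size kn <= \sum_(y in N :\: K) a y.
  by rewrite -DE -sum1_card leq_sum // => y _; exact: cert_gt0 cert y.
have upper : \sum_(y in N :\: K) a y <= (degree (v j) - size kn) * a r.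
  rewrite -DE -sum_nat_const leq_sum // => y _.
  by case/orP: (cert_max cert y) => [/ltnW|/andP[/eqP->]].
by rewrite KNle eigen; apply/andP; split; lia.
Qed.

Lemma dotZ_int (s t : seq int) :
  dotZ (map Z_of_int s) (map Z_of_int t) = Z_of_int (dot s t).
Proof.
rewrite /dotZ /dot; elim: s t => [|x s IHs] [|y t] //=.
by rewrite IHs rmorphD rmorphM.
Qed.

Lemma local_test_copy (tests : seq (seq int)) x :
  all (test_valid m) tests -> x < size vs ->
  local_test (a r) (map (map Z_of_int) tests) labs rows x.
Proof.
move=> tests_ok xn; rewrite /local_test label_copy //=.
case: ifP => // /andP[xr /allP xrow].
have [e eE e_test] := cert_tests cert (v x).
set q2s := [seq entry2 labs rows x z | z <- iota 0 (size labs)].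
have vE z : z < size vs -> nth 0 q2s z = q2 (v x) (v z).
  move=> zn; rewrite (nth_map 0) ?size_iota /labs ?size_map // nth_iota //.
  by rewrite add0n entry2_copy.
have m3E : degree (v x) * nth 0 q2s x + sumn [seq nth 0 q2s y | y <- row rows x] =
    q3 (v x).
  rewrite vE // /q3 sum_q1 (sum_row _ xr) sumnE big_map; congr (_ + _).
  by apply: eq_big_seq => y yx; rewrite vE ?(copy_row_bound copy xr yx).
have m4E : sumn [seq q * q | q <- q2s] = q4 (v x).
  rewrite /q4 (bigID [in vs]) /= [X in _ + X]big1 ?addn0; last first.
    by move=> z zvs; rewrite (q2_outside xr xrow zvs).
  rewrite -big_uniq ?(copy_uniq copy) //= sumnE !big_map.
  rewrite -[in RHS](mkseq_nth r vs) /mkseq big_map size_map.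
  by apply: eq_big_seq => z; rewrite mem_iota /= add0n => zn; rewrite entry2_copy.
rewrite m3E m4E all_map; apply/allP => t /(allP tests_ok) t_ok /=.
(* The division is exact, since e * a r = a x ^ 2. *)
have -> : Z.div (Z.mul (Z.of_nat (a (v x))) (Z.of_nat (a (v x)))) (Z.of_nat (a r)) =
    Z.of_nat e.
  have ar0 := cert_gt0 cert r.
  rewrite (_ : Z.mul _ _ = Z.mul (Z.of_nat e) (Z.of_nat (a r))); last by lia.
  by rewrite Z.div_mul //; lia.
have := e_test t t_ok; set w := [:: 1%R; _; _; _; _; _] => w_ge0.
rewrite (_ : [:: Zpos xH; _; _; _; _; _] = map Z_of_int w).
  by rewrite dotZ_int; apply/Z.leb_le; move: w_ge0; lia.
by rewrite /w /= rmorphN.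
Qed.

End Copy.

(** When every listed vertex has its row, the list is closed under adjacency and contains r, so
    connectedness makes it everything. *)
Lemma all_copied vs rows : partial_copy vs rows -> size rows = size vs ->
  forall x, x \in vs.
Proof.
move=> copy sz x.
have r_in : r \in vs.
  have [vs0 <-] := copy_root copy; apply: mem_nth; by case: (vs) vs0.
have /connectP[p rp ->] := (cert_conn cert).2 r x.
suff step z : z \in vs -> path (@adj G) z p -> last z p \in vs by exact: step.
elim: p z {rp} => [|y p IHp] z z_in //= /andP[zy yp].
apply: (IHp y _ yp); have zi : index z vs < size rows by rewrite sz index_mem.
have := copy_row_adj copy zi y; rewrite nth_index // [in LHS]/in_mem /= zy.
move/esym/mapP => [j jz ->].
exact/mem_nth/(copy_row_bound copy zi).
Qed.

(** This turns a reordering of labels, as produced by [fresh_complete], into a reordering of the new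
    vertices themselves. *)
Lemma perm_map_lift (T U : eqType) (f : T -> U) s (t : seq U) :
  perm_eq (map f s) t -> exists2 s', perm_eq s s' & t = map f s'.
Proof.
elim: t s => [|y t IHt] s st.
  by exists [::]; move: (perm_size st); rewrite size_map; case: (s).
have : y \in map f s by rewrite (perm_mem st) mem_head.
case/mapP => x xs yE.
have : perm_eq (map f (rem x s)) t.
  rewrite -(perm_cons y) (perm_trans _ st) // perm_sym {1}yE -map_cons.
  exact: perm_map (perm_to_rem xs).
case/IHt => s' s'_perm ->; exists (x :: s'); last by rewrite yE.
by rewrite (perm_trans (perm_to_rem xs)) // perm_cons.
Qed.

Variables (L : seq (nat * nat)) (tests : seq (seq int)).
Hypothesis L_pairwise : pairwise (fun l l' : nat * nat => l'.1 <= l.1) L.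
Hypothesis L_complete : forall x, vlabel x \in L.
Hypothesis tests_ok : all (test_valid m) tests.

(** At each step the actual neighbourhood of the next vertex is, up to the order of the new
    vertices, one of the enumerated choices, and the graph passes all tests. So the recursion can be
    followed down to a leaf, where [final] must hold. *)
Lemma search_sound final fuel vs rows :
  partial_copy vs rows ->
  search final m (a r) (Z.of_nat ((m.-1)`! * a r)) L (map (map Z_of_int) tests)
    fuel (map vlabel vs) rows ->
  exists vs' rows', [/\ partial_copy vs' rows', size rows' = size vs' &
    final (map vlabel vs') rows'].
Proof.
elim: fuel vs rows => // fuel IH vs rows copy.
rewrite [search _ _ _ _ _ _ _ _ _]/= size_map.
case: eqP => [sz fin|/eqP sz]; first by exists vs, rows.
set k := size rows in sz *; set n := size vs in sz *.
have kn : k < n by rewrite ltn_neqAle sz (copy_size copy).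
rewrite label_copy // [vlabel _]/=; set x := nth r vs k.
set I := known rows k.
have IE : I = [seq i <- iota 0 k | adj x (nth r vs i)] by exact: known_copy.
set J := [seq j <- iota k.+1 (n - k.+1) | adj x (nth r vs j)].
(* The position k of x itself drops out by irreflexivity. *)
have IJE : I ++ J = [seq i <- iota 0 n | adj x (nth r vs i)].
  have -> : iota 0 n = iota 0 k ++ iota k (n - k.+1).+1.
    by rewrite -(iotaD 0); congr (iota _ _); lia.
  by rewrite filter_cat IE /= -/x adj_irrefl.
have IJn : {in I ++ J, forall i, i < n}.
  by move=> i; rewrite IJE mem_filter mem_iota => /andP[].
have In : {in I, forall i, i < n} by move=> i iI; rewrite IJn // mem_cat iI.
have Jn : {in J, forall i, i < n} by move=> i iI; rewrite IJn // mem_cat iI orbT.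
have IJuniq : uniq (I ++ J) by rewrite IJE filter_uniq ?iota_uniq.
have mapIJ : map (nth r vs) (I ++ J) = filter (adj x) vs.
  by rewrite IJE -filter_map -/(mkseq _ _) mkseq_nth.
(* The neighbours of x not yet discovered; below, [F'] is the same list in the order chosen by
   [fresh]. *)
pose F := [seq y <- enum G | adj x y && (y \notin vs)].
have nbrs (R : nmodType) (f : G -> R) : (\sum_(y | adj x y) f y =
    \sum_(i <- I ++ J) f (nth r vs i) + \sum_(y <- F) f y)%R.
  rewrite -(big_map (nth r vs) xpredT) mapIJ (bigID [in vs]) /=; congr (_ + _)%R.
    rewrite big_filter [RHS]big_mkcond [RHS]big_uniq ?(copy_uniq copy) //=.
    by rewrite -[RHS]big_mkcondr; apply: eq_bigl => y; rewrite andbC.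
  by rewrite big_filter big_enum_cond.
have deg_split : degree x = size (I ++ J) + size F.
  rewrite /degree cardsE -sum1_card (nbrs _ (fun=> 1)).
  by rewrite !sum1_size.
pose w s := \sum_(i <- s) a (nth r vs i).
have wI : weight (map vlabel vs) I = w I by exact: weight_copy.
have wJ : weight (map vlabel vs) J = w J by exact: weight_copy.
have a_split : (m - degree x) * a x = w I + w J + \sum_(y <- F) a y.
  rewrite mulnBl -(cert_eigen cert) addKn nbrs /w big_cat //.
move/allP/(_ (J, (degree x - size I - size J,
  (m - degree x) * a x - weight (map vlabel vs) I - weight (map vlabel vs) J))).
rewrite a_split deg_split size_cat wI wJ.
have -> : size I + size J + size F - size I = size J + size F by lia.
have -> : size J + size F - size J = size F by lia.
have -> : w I + w J + \sum_(y <- F) a y - w I = w J + \sum_(y <- F) a y by lia.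
have -> : w J + \sum_(y <- F) a y - w J = \sum_(y <- F) a y by lia.
have /[swap]/[apply] : (J, (size F, \sum_(y <- F) a y)) \in
   picks (map vlabel vs) (iota k.+1 (n - k.+1)) (size J + size F) (w J + \sum_(y <- F) a y).
  have := @picks_complete (map vlabel vs) (fun j => adj x (nth r vs j))
     (iota k.+1 (n - k.+1)) (size J + size F) (w J + \sum_(y <- F) a y).
  rewrite -/J wJ => /(_ (leq_addr _ _) (leq_addr _ _)).
  by rewrite !addKn.
have FL : {subset map vlabel F <= L} by move=> l /mapP[y _ ->].
have sumF : sumn [seq l.1 | l <- map vlabel F] = \sum_(y <- F) a y.
  by rewrite sumnE !big_map.
have [s' F_perm s'_in] := fresh_complete L_pairwise FL (size_map _ _) sumF.
have [F' FF' s'E] := perm_map_lift F_perm; rewrite {s'}s'E in F_perm s'_in.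
move/allP/(_ _ s'_in) => /=.
rewrite -map_cat size_map; set rows' := rcons _ _; set vs' := vs ++ F'.
have F'E y : (y \in F') = adj x y && (y \notin vs).
  by rewrite -(perm_mem FF') mem_filter mem_enum andbT.
have sz' : size rows' = k.+1 by rewrite size_rcons.
set row' := (I ++ J) ++ iota n (size F') in rows' sz' *.
have row'_lt : {in row', forall j, j < size vs'}.
  move=> j; rewrite size_cat mem_cat mem_iota => /orP[/IJn jn|/andP[]//].
  exact: ltn_addr.
have nth' i : i < n -> nth r vs' i = nth r vs i by move=> i_n; rewrite nth_cat i_n.
have rowE i : i < k -> row rows' i = row rows i by move=> ik; rewrite /row nth_rcons ik.
have rowk : row rows' k = row' by rewrite /row nth_rcons ltnn eqxx.
have rowP (P : nat -> Prop) : (forall i, i < k -> P i) -> P k ->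
    forall i, i < size rows' -> P i.
  by move=> Pk Pkk i; rewrite sz' ltnS leq_eqVlt => /predU1P[->|/Pk].
have map_row' : map (nth r vs') row' = filter (adj x) vs ++ F'.
  rewrite map_cat -mapIJ; congr (_ ++ _).
    by apply/eq_in_map => i /IJn /nth'.
  rewrite -[in RHS](mkseq_nth r F') /mkseq -[n in iota n]addn0 iotaDl -map_comp.
  by apply: eq_map => i; rewrite /= nth_cat -/n ltnNge leq_addr addKn.
have copy' : partial_copy vs' rows'.
  split.
  - split; first by rewrite /vs' -size_eq0 size_cat -/n addn_eq0 (gtn_eqF (leq_ltn_trans _ kn)).
    by rewrite nth' ?(copy_root copy).2 ?(leq_ltn_trans _ kn).
  - rewrite cat_uniq (copy_uniq copy) -(perm_uniq FF') filter_uniq ?enum_uniq // andbT.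
    by apply/hasPn => y; rewrite F'E => /andP[].
  - by rewrite sz' size_cat ltn_addr.
  - apply: rowP => [i ik|]; first by rewrite rowE ?(copy_row_uniq copy).
    rewrite rowk cat_uniq IJuniq iota_uniq andbT.
    by apply/hasPn => i; rewrite mem_iota => /andP[ni _]; apply/negP => /IJn; rewrite ltnNge ni.
  - apply: rowP => [i ik|]; last by rewrite rowk.
    rewrite rowE // size_cat => j /(copy_row_bound copy ik) jn; exact: ltn_addr.
  apply: rowP => [i ik y|y].
    rewrite rowE // nth' ?(ltn_trans ik) // (copy_row_adj copy ik); congr (y \in _).
    by apply/eq_in_map => j /(copy_row_bound copy ik) /nth'.
  rewrite rowk map_row' nth' // mem_cat mem_filter F'E [in LHS]/in_mem /= -/x.
  by case: (y \in vs); rewrite ?andbT ?andbF ?orbF.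
have k_lt : k < size vs' by rewrite size_cat ltn_addr.
rewrite (budget_test_copy copy').
have -> : all (degree_test m (a r) (map vlabel vs') rows') ((I ++ J) ++ iota n (size F')).
  by apply/allP => j /row'_lt; exact: degree_test_copy.
rewrite (local_test_copy copy' tests_ok k_lt).
have -> : all (local_test (a r) (map (map Z_of_int) tests) (map vlabel vs') rows')
    ((I ++ J) ++ iota n (size F')).
  by apply/allP => j /row'_lt; exact: local_test_copy.
exact: IH.
Qed.

End Soundness.

                        

(** * Tests at the leaves and tables for the search *)

Fixpoint column rows n (s : seq int) (y : nat) : seq int :=
  if s is j :: s' then
    let u := column rows n s' y in
    [seq (size (row rows i))%:Z * nth 0 u i +
         foldr +%R 0 [seq nth 0 u z | z <- row rows i] - j * nth 0 u i
    | i <- iota 0 n]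
  else [seq (i == y)%:R | i <- iota 0 n].

(** This compares the matrix M of the completed candidate with the rank-one matrix predicted by its
    labels. A candidate that fails does not come from a certificate and is discarded. *)
Definition column_test m labs rows (y : nat) :=
  let n := size labs in
  let u := column rows n (shifts m) y in
  all (fun x => nth 0 u x * ((label labs 0).1)%:Z ==
                ((label labs x).1 * (label labs y).1)%N%:Z) (iota 0 n).

Section Final.
Local Open Scope nat_scope.

Definition edge (E : seq (nat * nat)) (i j : nat) :=
  (i != j) && (((i, j) \in E) || ((j, i) \in E)).

                                                                               
(** A backtracking search that extends a partial isomorphism [p]. Its answer is rechecked by
    [iso_test], so nothing has to be proved about it. *)
Fixpoint find_iso fuel rows rows' n p : option (seq nat) :=
  if size p == n then Some p
  else if fuel is f.+1 then
    (fix try ts :=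
      if ts is t :: ts' then
        if t \in p then try ts'
        else if all (fun i => (t \in row rows' (nth 0 p i)) == (size p \in row rows i))
                    (iota 0 (size p)) then
          if find_iso f rows rows' n (rcons p t) is Some p' then Some p' else try ts'
        else try ts'
      else None) (iota 0 n)
  else None.

Definition iso_test rows n E (p : seq nat) :=
  [&& size p == n, uniq p, all (fun i => i < n) p &
      all (fun i => all (fun j => edge E (nth 0 p i) (nth 0 p j) == (j \in row rows i))
        (iota 0 n)) (iota 0 n)].

Definition iso_to rows (t : nat * seq (nat * nat)) :=
  let: (n, E) := t in
  if size rows == n then
    let rows' := [seq [seq j <- iota 0 n | edge E i j] | i <- iota 0 n] in
    if find_iso n rows rows' n [::] is Some p then iso_test rows n E p else false
  else false.

(** The edge lists of [G1] to [G8] in this order, with the vertex names evaluated, so that the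
    resulting graphs are convertible to the original ones. *)
Definition targets : seq (nat * seq (nat * nat)) := [::
  (3, [:: (0, 1); (0, 2); (1, 2)]);
  (6, [:: (0, 3); (0, 1); (0, 2); (1, 2); (3, 4); (3, 5); (4, 5)]);
  (4, [:: (0, 1); (0, 2); (0, 3); (1, 2); (1, 3); (2, 3)]);
  (10, [:: (0, 2); (2, 4); (4, 1); (1, 3); (3, 0);
           (5, 6); (6, 7); (7, 8); (8, 9); (9, 5);
           (0, 5); (1, 6); (2, 7); (3, 8); (4, 9)]);
  (6, [:: (0, 1); (0, 2); (1, 2); (3, 4); (3, 5); (4, 5);
          (0, 3); (1, 4); (2, 5)]);
  (10, [:: (0, 1); (0, 4); (1, 2); (2, 3); (3, 1);
           (4, 5); (5, 6); (6, 4); (2, 8); (6, 7);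
           (3, 7); (5, 8); (0, 9); (8, 9); (7, 9)]);
  (12, [:: (0, 1); (0, 2); (1, 2); (3, 0); (4, 1); (5, 2);
           (3, 6); (3, 7); (6, 7); (4, 8); (4, 9); (8, 9);
           (5, 10); (5, 11); (10, 11); (6, 9); (8, 11); (10, 7)]);
  (6, [:: (0, 3); (0, 1); (0, 2); (0, 5); (3, 4); (3, 5); (1, 2); (4, 5)])].

Definition leaf_test m labs rows :=
  if all (column_test m labs rows) (iota 0 (size labs)) then
    has (iso_to rows) targets
  else true.

                                                                          
(** Integrality of M x x = a x ^ 2 / a r restricts the possible values; they are listed in
    decreasing order as [fresh] requires. *)
Definition label_values er :=
  [seq a <- rev (iota 1 er) |
    Z.eqb (Z.modulo (Z.mul (Z.of_nat a) (Z.of_nat a)) (Z.of_nat er)) Z0].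
Definition labels m er dr :=
  [seq l <- [seq (a, d) | a <- label_values er, d <- iota 2 (m - 3)] |
    (l.1 < er) || (l.2 <= dr)].

                                                                                   
                                                                               
                                                                      
(** The test in position k (from 1) is a positive multiple of the Lagrange polynomial that vanishes
    on {1, ..., m - 1} except at k. Its value at m is cancelled by the sixth coefficient, so degree
    m - 2 suffices. It expresses that the eigenvalue k has nonnegative weight at the vertex. *)
Definition tests m : seq (seq int) :=
  match m with
  | 4 => [:: [:: 18; - 15; 3; 0; 0; 1];
             [:: - 6; 8; - 2; 0; 0; - 1];
             [:: 2; - 3; 1; 0; 0; 1]]
  | 5 => [:: [:: 96; - 104; 36; - 4; 0; - 1];
             [:: - 36; 57; - 24; 3; 0; 1];
             [:: 16; - 28; 14; - 2; 0; - 1];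
             [:: - 6; 11; - 6; 1; 0; 1]]
  | 6 => [:: [:: 600; - 770; 355; - 70; 5; 1];
             [:: - 240; 428; - 236; 52; - 4; - 1];
             [:: 120; - 234; 147; - 36; 3; 1];
             [:: - 60; 122; - 82; 22; - 2; - 1];
             [:: 24; - 50; 35; - 10; 1; 1]]
  | _ => [::]
  end%R.

Definition search_all m :=
  all (fun er => all (fun dr =>
      pairwise (fun l l' : nat * nat => l'.1 <= l.1) (labels m er dr) &&
      search (leaf_test m) m er (Z.of_nat ((m.-1)`! * er)) (labels m er dr)
        (map (map Z_of_int) (tests m)) 30 [:: (er, dr)] [::])
    (iota 2 (m - 3))) (iota 1 (m.-1)`!).

Lemma tests_valid m : all (test_valid m) (tests m).
Proof. by case: m => [|[|[|[|[|[|[|m]]]]]]]; vm_compute. Qed.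

End Final.

(** * Soundness of the leaf test *)

Section FinalSoundness.
Local Open Scope nat_scope.

Variables (G : sgraph) (m : nat) (r : G) (a : G -> nat).
Hypothesis cert : certificate m r a.
Variables (vs : seq G) (rows : seq (seq nat)).
Hypothesis copy : partial_copy r vs rows.
Hypothesis closed : size rows = size vs.
Let labs := map (vlabel a) vs.
Let v := nth r vs.

Lemma column_copy s y i : y < size vs -> i < size vs ->
  (nth 0 (column rows (size vs) s y) i = qcol s (v y) (v i))%R.
Proof.
move=> yn; elim: s i => [|j s IHs] i i_n /=.
  rewrite (nth_map 0) ?size_iota // nth_iota // add0n.
  by rewrite nth_uniq ?(copy_uniq copy).
rewrite (nth_map 0) ?size_iota // nth_iota // add0n IHs // /qop.
have ir : i < size rows by rewrite closed.
rewrite (degree_row copy ir) (sum_row copy _ ir) natz; congr (_ * _ + _ - _)%R.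
rewrite foldrE big_map; apply: eq_big_seq => z zi.
by rewrite IHs ?(copy_row_bound copy ir).
Qed.

Lemma column_test_copy y : y < size vs -> column_test m labs rows y.
Proof.
move=> yn; apply/allP => i; rewrite mem_iota size_map add0n => i_n.
have n0 : 0 < size vs by exact: leq_ltn_trans yn.
rewrite column_copy // !(@label_copy _ r) //= -/v.
have := cert_rank1 cert (v i) (v y); have [_ {1}<-] := copy_root copy.
by move=> ->.
Qed.

Lemma iso_test_sound n E p : n = size vs -> iso_test rows n E p ->
  isomorphic G (edge_list_graph n E).
Proof.
move=> nE /and4P[/eqP szp p_uniq /allP p_lt /allP p_adj].
have vs_all := all_copied cert copy closed.
have idx x : index x vs < n by rewrite nE index_mem.
have f_lt x : nth 0 p (index x vs) < n by rewrite p_lt // mem_nth ?szp.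
pose f x : edge_list_graph n E := Ordinal (f_lt x).
have f_inj : injective f.
  move=> x y [] /eqP; rewrite nth_uniq ?szp // => /eqP xy.
  by rewrite -(nth_index r (vs_all x)) xy nth_index.
exists f; split.
  apply: inj_card_bij => //; rewrite card_ord nE -(card_uniqP (copy_uniq copy)).
  exact: max_card.
move=> x y; have ix : index x vs < size rows by rewrite closed -nE.
have := p_adj (index x vs); rewrite mem_iota /= add0n idx => /(_ isT)/allP/(_ (index y vs)).
rewrite mem_iota /= add0n idx => /(_ isT)/eqP.
rewrite (mem_row copy ix) ?nth_index // -?nE // => <-.
Qed.

Lemma leaf_test_sound : leaf_test m labs rows ->
  exists2 t, t \in targets & isomorphic G (edge_list_graph t.1 t.2).
Proof.
rewrite /leaf_test size_map.
have -> : all (column_test m labs rows) (iota 0 (size vs)).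
  by apply/allP => y; rewrite mem_iota => /= yn; exact: column_test_copy.
case/hasP => -[n E] tE; rewrite /iso_to; case: eqP => // nE.
case: find_iso => // p /(iso_test_sound _) iso.
by exists (n, E) => //; apply: iso; rewrite -nE.
Qed.

End FinalSoundness.

(** * Running the search and concluding *)

Section Main.
Local Open Scope nat_scope.

Lemma labels_complete (G : sgraph) m (r : G) a : certificate m r a ->
  forall x, vlabel a x \in labels m (a r) (degree r).
Proof.
move=> cert x; rewrite mem_filter /=.
have [d2 dm] := cert_degree cert x; have a0 := cert_gt0 cert x.
have ar0 := cert_gt0 cert r.
have mx := cert_max cert x.
apply/andP; split.
  by case/orP: mx => [->//|/andP[_ ->]]; rewrite orbT.
apply/allpairsP; exists (a x, degree x); split => //; last by rewrite mem_iota /=; lia.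
have axr : a x <= a r by case/orP: mx => [/ltnW//|/andP[/eqP->]].
rewrite mem_filter mem_rev mem_iota a0 add1n ltnS axr andbT.
have [e eE _] := cert_tests cert x.
rewrite /= (_ : Z.mul _ _ = Z.mul (Z.of_nat e) (Z.of_nat (a r))); last by lia.
by rewrite Z.mod_mul //; lia.
Qed.

Lemma search_all_sound (G : sgraph) m (r : G) a : certificate m r a -> search_all m ->
  exists2 t, t \in targets & isomorphic G (edge_list_graph t.1 t.2).
Proof.
move=> cert /allP/(_ (a r)).
have a0 := cert_gt0 cert r; have [d2 dm] := cert_degree cert r.
(* The square of a r is one term of the sum of squares, which equals (m - 1)! * a r. *)
have ar : a r <= (m.-1)`!.
  rewrite -(leq_pmul2r a0) -(cert_total cert) (bigD1 r) //= -mulnn leq_addr //.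
have ar_in : a r \in iota 1 (m.-1)`! by rewrite mem_iota a0 add1n ltnS.
have dr_in : degree r \in iota 2 (m - 3) by rewrite mem_iota; lia.
move=> /(_ ar_in)/allP/(_ _ dr_in)/andP[pw srch].
have copy : partial_copy r [:: r] [::] by [].
have [vs [rows [copy' closed fin]]] :=
  search_sound cert pw (labels_complete cert) (tests_valid m) copy srch.
exact: (leaf_test_sound cert copy' closed fin).
Qed.

Lemma search_all4 : search_all 4.
Proof. by vm_compute. Qed.
Lemma search_all5 : search_all 5.
Proof. by vm_compute. Qed.
Lemma search_all6 : search_all 6.
Proof. by vm_compute. Qed.

End Main.

Theorem theorem1p2 (G : sgraph) (mu : algC)
    (hconn : connected G) (hnbip : ~ bipartite G) (hint : Q_integral G)
    (hmu : Q_spectral_radius G mu) (hmu6 : mu <= 6) :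
  isomorphic G G1 \/ isomorphic G G2 \/ isomorphic G G3 \/ isomorphic G G4 \/
  isomorphic G G5 \/ isomorphic G G6 \/ isomorphic G G7 \/ isomorphic G G8.
Proof.
have [m [r [a cert]]] := certificate_exists hconn hnbip hint hmu hmu6.
have m_search : search_all m.
  have := cert_m cert; have [d2 dm] := cert_degree cert r => m6.
  (* The bounds 2 <= degree r <= m - 2 force m >= 4. *)
  have [->|[->|->]] : m = 4%N \/ m = 5%N \/ m = 6%N by lia.
  - exact: search_all4.
  - exact: search_all5.
  exact: search_all6.
have [t] := search_all_sound cert m_search.
(* One case for each entry of [targets], which matches the corresponding graph by conversion. *)
rewrite !inE; do 7?[case/orP => [/eqP->|]]; last move/eqP->; by tauto.
Qed.
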